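(* Let $s\in\{2,3,\dots\}$ be fixed. Let $X_1,X_2,\dots$ be independent observations on a random variable $X$ with absolutely continuous c.d.f. $F$ and p.d.f. $f=F'$, and assume $f\left[F^{\leftarrow}\left(\frac1{s+1}\right)\right]\in(0,\infty)$ and $f\left[F^{\leftarrow}\left(\frac s{s+1}\right)\right]\in(0,\infty)$. Then, as $k\to\infty$, $$\frac{n_L\left(\frac1{s+1};(s+1)k-1\right)}{(s+1)k-1}\stackrel{a.s.}{\to}p_{L,\frac1{s+1}}(X),\qquad\frac{n_R\left(\frac1{s+1};(s+1)k-1\right)}{(s+1)k-1}\stackrel{a.s.}{\to}p_{R,\frac1{s+1}}(X),$$ where $\stackrel{a.s.}{\to}$ denotes almost sure convergence.
   Context: For an absolutely continuous c.d.f. $F$ of $X$ and $q\in(0,1)$, the quantile function is $F^{\leftarrow}(q)=\inf\{x\in\mathbb R:F(x)\ge q\}=\sup\{x\in\mathbb R:F(x)\le q\}$ (the equality of the two expressions is part of the convention). For $p\in(0,0.5]$ the theoretical fences are $$R(X,p)=\tfrac1pF^{\leftarrow}(1-p)-\tfrac{1-p}{p}F^{\leftarrow}(p),\qquad L(X,p)=\tfrac1pF^{\leftarrow}(p)-\tfrac{1-p}{p}F^{\leftarrow}(1-p),$$ and $p_{L,p}(X)=P(X<L(X,p))$, $p_{R,p}(X)=P(X>R(X,p))$. For a sample $X_1,\dots,X_n$ with order statistics $X_{(1,n)}\le\dots\le X_{(n,n)}$, the empirical $q$-quantile is $F_n^{\leftarrow}(q)=X_{([(n+1)q],n)}$ for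 $q\in[\frac1{n+1},\frac n{n+1}]$, where $[a]$ is the integer part of $a$. The empirical fences are $$R_n(X,p)=\tfrac1pF_n^{\leftarrow}(1-p)-\tfrac{1-p}{p}F_n^{\leftarrow}(p),\qquad L_n(X,p)=\tfrac1pF_n^{\leftarrow}(p)-\tfrac{1-p}{p}F_n^{\leftarrow}(1-p).$$ The number of (empirical) left $p$-outside values $n_L(p;n)$ is the number of indices $i\le n$ with $X_i<L_n(X,p)$, and the number of right $p$-outside values $n_R(p;n)$ is the number of indices $i\le n$ with $X_i>R_n(X,p)$. *)

(* Defs.v *)
From HB Require Import structures.
From mathcomp Require Import all_boot all_order all_algebra archimedean finmap.
From mathcomp Require Import all_classical all_reals all_analysis.

Set Implicit Arguments.
Unset Strict Implicit.
Unset Printing Implicit Defensive.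

Import Order.TTheory GRing.Theory Num.Theory.
Import numFieldNormedType.Exports.

Local Open Scope classical_set_scope.
Local Open Scope ring_scope.

(* Absolute continuity of a real function on the line.  For a monotone bounded
   function the global and the local (compact intervals) notions coincide. *)
Definition abs_continuous (R : realType) (F : R -> R) : Prop :=
  forall e : R, 0 < e -> exists2 d : R, 0 < d &
    forall (m : nat) (a b : 'I_m -> R),
      (forall i, a i <= b i) ->
      trivIset [set: 'I_m] (fun i => `]a i, b i[%classic) ->
      \sum_(i < m) (b i - a i) < d ->
      \sum_(i < m) `|F (b i) - F (a i)| < e.

(* With Q the quantile function of X (resp. of a sample), these are the
   theoretical (resp. empirical) fences. *)
Definition right_fence (R : realType) (Q : R -> R) (p : R) : R :=
  p^-1 * Q (1 - p) - (1 - p) / p * Q p.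

Definition left_fence (R : realType) (Q : R -> R) (p : R) : R :=
  p^-1 * Q p - (1 - p) / p * Q (1 - p).

Section theoretical.
Context d (T : measurableType d) (R : realType) (P : probability T R).
Variable X : {RV P >-> R}.

Definition rcdf (x : R) : R := fine (cdf X x).

(* The derivative is meaningful only where rcdf is derivable. *)
Definition pdf : R -> R := derive1 rcdf.

Definition quantile (q : R) : R := inf [set x | q <= rcdf x].

(* The convention F^<-(q) = inf {x | F x >= q} = sup {x | F x <= q}. *)
Definition quantile_convention (q : R) : Prop :=
  quantile q = sup [set x | rcdf x <= q].

(* f(F^<-(q)) lies in (0, oo), where f = F': the derivative exists as a finite
   real number and is positive. *)
Definition pdf_quantile_pos_finite (q : R) : Prop :=
  derivable rcdf (quantile q) 1 /\ 0 < pdf (quantile q).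

Definition p_left (p : R) : R :=
  fine (P [set w | X w < left_fence quantile p]).

Definition p_right (p : R) : R :=
  fine (P [set w | right_fence quantile p < X w]).

(* X_ is a sequence of independent observations on X; the sequence is indexed
   from 0, so that X_ i stands for the observation number i.+1. *)
Definition mutually_independent (X_ : nat -> {RV P >-> R}) : Prop :=
  forall (J : {fset nat}) (B : nat -> set R),
    (forall i, measurable (B i)) ->
    P (\bigcap_(i in [set` J]) (X_ i @^-1` B i)) =
    (\prod_(i <- J) P (X_ i @^-1` B i))%E.

Definition independent_observations (X_ : nat -> {RV P >-> R}) : Prop :=
  mutually_independent X_ /\
  forall (i : nat) (B : set R), measurable B ->
    distribution P (X_ i) B = distribution P X B.

End theoretical.

Section empirical.
Context (R : realType).
(* The sample of size n consists of x 0, ..., x n.-1. *)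
Variables (x : nat -> R) (n : nat).

(* The j-th smallest sample value, for 1 <= j <= n. *)
Definition order_stat (j : nat) : R :=
  nth 0 (sort <=%R [seq x i | i <- iota 0 n]) j.-1.

(* Meaningful for 1/(n+1) <= q <= n/(n+1). *)
Definition emp_quantile (q : R) : R := order_stat (Num.truncn (n.+1%:R * q)).

Definition n_left (p : R) : nat :=
  #|[pred i : 'I_n | x i < left_fence emp_quantile p]|.

Definition n_right (p : R) : nat :=
  #|[pred i : 'I_n | right_fence emp_quantile p < x i]|.

End empirical.

(* Main.v *)
(** Applying the second-moment strong law to the events [X_i <= t] for rational [t],
    almost every sample path has empirical distribution functions converging to [F]
    at all rationals at once.  On such a path everything is deterministic.  The
    convention [inf {x | q <= F x} = sup {x | F x <= q}] says that [F < q] on the left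
    and [F > q] on the right of the [q]-quantile, which forces the order statistics of
    rank [q (n + 1)] to converge to it; for [n = (s + 1) k - 1] and [q = 1 / (s + 1)]
    or [s / (s + 1)] this rank is an integer.  The empirical fences therefore converge
    to the theoretical ones, and squeezing them between rationals close to the limit
    transfers the convergence to the proportion of outside values, since [F] is
    continuous.

    The strong law follows from Chebyshev's inequality and the Borel-Cantelli lemma
    along the squares [n = m ^ 2]; between squares the centred counts move little. *)

Require Import Defs.
From HB Require Import structures.
From mathcomp Require Import all_boot all_order all_algebra archimedean finmap.
From mathcomp Require Import all_classical all_reals all_analysis.
From mathcomp Require Import measurable_realfun zify ring lra.

Set Implicit Arguments.
Unset Strict Implicit.
Unset Printing Implicit Defensive.

Import Order.TTheory GRing.Theory Num.Theory.
Import numFieldNormedType.Exports.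

Local Open Scope classical_set_scope.
Local Open Scope ring_scope.

(** * Second moments of the number of events occurring among the first [n] *)

Lemma Lfun2_indic {d : measure_display} {T : measurableType d} {R : realType}
    (P : probability T R) (A : set T) :
  measurable A -> (\1_A : T -> R) \in Lfun P 2%:E.
Proof.
move=> mA; rewrite inE; apply/andP; split; rewrite inE/=.
  exact: measurable_indic.
rewrite /finite_norm unlock poweR_lty//.
apply: (@le_lt_trans _ _ (\int[P]_x cst 1%E x)%E); last first.
  rewrite integral_cst// mul1e.
  by apply: (le_lt_trans (probability_le1 P measurableT)); rewrite ltry.
apply: ge0_le_integral => //.
- by move=> x _; exact: poweR_ge0.
- apply/measurable_EFinP; apply: (measurableT_comp (measurable_powR _)) => //.
  apply: measurableT_comp => //; exact: measurable_indic.
- move=> x _; rewrite /= lee_fin indicE.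
  by case: (x \in A); rewrite ?normr1 ?powR1// normr0 powR0.
Qed.

Section event_count.
Context {d : measure_display} {T : measurableType d} {R : realType}.
Variables (P : probability T R) (A : nat -> set T) (p : R).
Hypothesis mA : forall i, measurable (A i).
Hypothesis PA : forall i, P (A i) = p%:E.
Hypothesis PAI : forall i j, i != j -> P (A i `&` A j) = (p * p)%:E.

Definition event_count (n : nat) (w : T) : R := \sum_(i < n) \1_(A i) w.

Lemma event_countS n : event_count n.+1 = (event_count n \+ \1_(A n))%R.
Proof. by apply/funext => w; rewrite /event_count big_ord_recr. Qed.

Lemma measurable_event_count n : measurable_fun setT (event_count n).
Proof. by apply: measurable_sum => i; exact: measurable_indic. Qed.

Lemma Lfun2_event_count n : event_count n \in Lfun P 2%:E.
Proof.
elim: n => [|n IH].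
  rewrite (_ : event_count 0 = cst 0) ?Lfun_cst//.
  by apply/funext => w; rewrite /event_count big_ord0.
by rewrite event_countS rpredD ?lee1n//= Lfun2_indic.
Qed.

Lemma expectation_event_count n : ('E_P[event_count n] = (n%:R * p)%:E)%E.
Proof.
have Pfin : P setT \is a fin_num := fin_num_measure P _ measurableT.
elim: n => [|n IH].
  rewrite (_ : event_count 0 = cst 0) ?expectation_cst ?mul0r//.
  by apply/funext => w; rewrite /event_count big_ord0.
rewrite event_countS expectationD ?IH; first last.
- by rewrite Lfun_subset12 ?Lfun2_indic.
- by rewrite Lfun_subset12 ?Lfun2_event_count.
by rewrite expectation_indic// PA -EFinD -[n.+1]addn1 natrD mulrDl mul1r.
Qed.

(** Covariance is additive in its first argument, and pairwise independence makes each earlier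
    indicator uncorrelated with that of [A m]. *)
Lemma covariance_event_count n m : (n <= m)%N ->
  covariance P (event_count n) \1_(A m) = 0%E.
Proof.
have Pfin : P setT \is a fin_num := fin_num_measure P _ measurableT.
elim: n => [|n IH] nm.
  rewrite (_ : event_count 0 = cst 0) ?covariance_cst_l//.
  by apply/funext => w; rewrite /event_count big_ord0.
rewrite event_countS covarianceDl ?Lfun2_indic ?Lfun2_event_count//.
rewrite IH ?(ltnW nm)// add0e covarianceE; last first.
- by rewrite Lfun2_mul_Lfun1 ?Lfun2_indic.
- by rewrite Lfun_subset12 ?Lfun2_indic.
- by rewrite Lfun_subset12 ?Lfun2_indic.
rewrite -[(_ * _)%R]/(\1_(A n) \* \1_(A m))%R -indicI.
rewrite !expectation_indic//; last exact: measurableI.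
by rewrite PAI ?ltn_eqF// !PA -EFinM -EFinB subrr.
Qed.

(** Without covariance terms the variances add up, and each indicator contributes [p - p^2 <= 1]. *)
Lemma variance_event_count_le n : ('V_P[event_count n] <= n%:R%:E)%E.
Proof.
have Pfin : P setT \is a fin_num := fin_num_measure P _ measurableT.
elim: n => [|n IH].
  rewrite (_ : event_count 0 = cst 0) ?variance_cst//.
  by apply/funext => w; rewrite /event_count big_ord0.
rewrite event_countS varianceD ?Lfun2_indic ?Lfun2_event_count//.
rewrite covariance_event_count// mule0 adde0 -natr1 EFinD leeD//.
rewrite varianceE ?Lfun2_indic// expectation_indic// PA.
have -> : (\1_(A n) : T -> R) ^+ 2 = \1_(A n).
  by rewrite expr2 -[LHS]/(\1_(A n) \* \1_(A n))%R -indicI setIid.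
rewrite expectation_indic// PA -EFin_expe -EFinB lee_fin.
have := probability_le1 P (mA n); rewrite PA lee_fin.
have := sqr_ge0 p; lra.
Qed.

(** For [0 < n] this is the event that the relative frequency misses [p] by at least [e], written
    without division. *)
Definition count_deviation (e : R) (n : nat) : set T :=
  [set w | e * n%:R <= `|event_count n w - n%:R * p|].

Lemma measurable_count_deviation e n : measurable (count_deviation e n).
Proof.
rewrite /count_deviation -[X in measurable X]setTI.
apply: (@measurable_fun_le _ _ _ setT (cst (e * n%:R))
  (fun w => `|event_count n w - n%:R * p|)) => //.
apply: measurableT_comp => //; apply: measurable_funB => //.
exact: measurable_event_count.
Qed.

(** Chebyshev divides the variance, at most [n], by [(e n)^2]. A bound of order [1 / n] becomes
    summable along the squares. *)
Lemma count_deviation_le e n : 0 < e -> (0 < n)%N ->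
  (P (count_deviation e n) <= (e ^- 2 * n%:R^-1)%:E)%E.
Proof.
move=> e0 n0.
have en0 : 0 < e * n%:R by rewrite mulr_gt0// ltr0n.
pose S : {mfun T >-> R} := HB.pack (event_count n)
  (isMeasurableFun.Build _ _ _ _ (event_count n) (measurable_event_count n)).
have := chebyshev (S : {RV P >-> R}) en0.
rewrite [X in fine X]expectation_event_count /= => /le_trans; apply.
apply: (@le_trans _ _ (((e * n%:R) ^- 2)%:E * n%:R%:E)%E).
  by rewrite lee_pmul2l ?lte_fin ?invr_gt0 ?exprn_gt0// variance_event_count_le.
have n0' : n%:R != 0 :> R by rewrite pnatr_eq0 -lt0n.
rewrite -EFinM lee_fin le_eqVlt; apply/orP; left; apply/eqP.
by field; rewrite n0' gt_eqF.
Qed.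

End event_count.

(** * Almost sure convergence of the frequencies of events *)

Lemma nneseries_inv_sq_lt {R : realType} :
  (\sum_(0 <= m <oo) ((m.+1 ^ 2)%:R^-1 : R)%:E < +oo)%E.
Proof.
(* The sum telescopes through [1 / (m + 1)^2 <= 1 / m - 1 / (m + 1)]; since [0^-1 = 0], the first
   term is treated apart. *)
have le2 n : \sum_(0 <= m < n) ((m.+1 ^ 2)%:R^-1 : R) <= 2 - n%:R^-1.
  elim: n => [|n IH]; first by rewrite big_geq// invr0; lra.
  rewrite big_nat_recr//=; case: n IH => [_|n IH].
    by rewrite big_geq// add0r; lra.
  suff : ((n.+2 ^ 2)%:R^-1 : R) <= n.+1%:R^-1 - n.+2%:R^-1.
    by move=> /(lerD IH) /le_trans; apply; rewrite addrA subrK.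
  have n1 : 0 < n.+1%:R :> R by rewrite ltr0n.
  have -> : n.+1%:R^-1 - n.+2%:R^-1 = (n.+1 * n.+2)%:R^-1 :> R.
    by rewrite natrM -(natr1 n.+1); field; rewrite !gt_eqF// addr_gt0.
  by rewrite lef_pV2 ?posrE ?ltr0n// ler_nat; lia.
apply: (@le_lt_trans _ _ 2%:E); last by rewrite ltry.
apply: lime_le.
  by apply: is_cvg_nneseries => m _ _; rewrite lee_fin invr_ge0.
apply: nearW => n; rewrite sumEFin lee_fin (le_trans (le2 n))//.
by rewrite lerBlDr lerDl invr_ge0.
Qed.

(** The exceptional set is the upper limit of [F]: it is null by Borel-Cantelli, and a point outside
    it lies in finitely many [F m]. *)
Lemma borel_cantelli_ae {d : measure_display} {T : measurableType d}
    {R : realType} (mu : {measure set T -> \bar R}) (F : nat -> set T) :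
  (forall m, measurable (F m)) -> (\sum_(0 <= m <oo) mu (F m) < +oo)%E ->
  {ae mu, forall w, \forall m \near \oo, ~ F m w}.
Proof.
move=> mF Foo; exists (lim_sup_set F); split.
- by apply: bigcap_measurable => // n _; apply: bigcup_measurable => k _.
- exact: lim_sup_set_cvg0.
move=> w nw n _; apply: contrapT => nF; apply: nw.
by exists n => // m /= nm Fm; apply: nF; exists m.
Qed.

(* Between consecutive squares [m^2 <= n < (m+1)^2] a 1-Lipschitz sequence moves by
   at most [2m], which is negligible with respect to [n]. *)
Lemma lipschitz_cvg_squares {R : realType} (D : nat -> R) :
  (forall n, `|D n.+1 - D n| <= 1) ->
  (forall e : R, 0 < e ->
    \forall m \near \oo, `|D (m.+1 ^ 2)%N| < e * (m.+1 ^ 2)%:R) ->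
  D n / n%:R @[n --> \oo] --> (0 : R).
Proof.
move=> lip sq.
have lipD m k : `|D (m + k)%N - D m| <= k%:R.
  elim: k => [|k IH]; first by rewrite addn0 subrr normr0.
  rewrite addnS -natr1 [leRHS]addrC.
  by rewrite (le_trans (ler_distD (D (m + k)%N) _ _))// lerD ?lip.
apply/cvgrPdist_le => e e0.
have e2 : 0 < e / 2 by rewrite divr_gt0.
have [M _ HM] := sq _ e2.
(* For [m >= K] one has [4 <= e m], so the drift [2 m] is at most [(e / 2) m^2 <= (e / 2) n]; the
   other half of [e] pays for the value at [m^2]. *)
have [K eK] : exists K : nat, 4 / e < K%:R.
  by exists (Num.truncn (4 / e)).+1; exact: truncnS_gt.
near=> n; rewrite sub0r normrN.
pose m := Nat.sqrt n.
have [mn nm] : (m ^ 2 <= n)%N /\ (n <= m ^ 2 + 2 * m)%N.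
  by have := PeanoNat.Nat.sqrt_specif n; rewrite -/m; lia.
have [m' m'E Mm'] : exists2 m', m = m'.+1 & (M <= m')%N.
  exists m.-1.
    have : (1 <= n)%N by near: n; exact: nbhs_infty_ge.
    by lia.
  have : (M.+1 ^ 2 <= n)%N by near: n; exact: nbhs_infty_ge.
  by have := PeanoNat.Nat.sqrt_specif n; rewrite -/m; nia.
have mK : (K <= m)%N.
  have : (K ^ 2 <= n)%N by near: n; exact: nbhs_infty_ge.
  by have := PeanoNat.Nat.sqrt_specif n; rewrite -/m; nia.
have := HM _ Mm'; rewrite -m'E => Dm.
have n0 : 0 < n%:R :> R by rewrite ltr0n; lia.
rewrite normrM normfV (ger0_norm (ltW n0)) ler_pdivrMr//.
have := lipD (m ^ 2)%N (n - m ^ 2)%N; rewrite subnKC// => Dn.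
have : `|D n| <= `|D n - D (m ^ 2)%N| + `|D (m ^ 2)%N|.
  by rewrite -[X in `|X| <= _](subrK (D (m ^ 2)%N)) ler_normD.
have : (n - m ^ 2)%:R <= 2 * m%:R :> R by rewrite -natrM ler_nat; lia.
have : 2 * m%:R <= e / 2 * n%:R.
  rewrite mulrAC ler_pdivlMr//.
  apply: (@le_trans _ _ (e * (m%:R * m%:R))); last first.
    by rewrite ler_pM2l// -natrM ler_nat mulnn.
  have : 4 <= e * m%:R.
    rewrite mulrC -ler_pdivrMr//; apply: (le_trans (ltW eK)).
    by rewrite ler_nat.
  have : 0 <= m%:R :> R by []. 
  nra.
have : e / 2 * (m ^ 2)%:R <= e / 2 * n%:R by rewrite ler_pM2l// ler_nat.
move: Dm Dn; set a := e / 2 * n%:R; have -> : e * n%:R = 2 * a by rewrite /a; field.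
lra.
Unshelve. all: by end_near. Qed.

Lemma strong_law_events {d : measure_display} {T : measurableType d}
    {R : realType} (P : probability T R) (A : nat -> set T) (p : R) :
  (forall i, measurable (A i)) -> (forall i, P (A i) = p%:E) ->
  (forall i j, i != j -> P (A i `&` A j) = (p * p)%:E) ->
  {ae P, forall w, (\sum_(i < n) \1_(A i) w) / n%:R @[n --> \oo] --> p}.
Proof.
move=> mA PA PAI.
have [p0 p1] : 0 <= p /\ p <= 1.
  by rewrite -!lee_fin -(PA 0%N) probability_le1.
(* Countably many tolerances [1 / (j + 1)] leave a single null set, outside of which every [e > 0]
   is covered. *)
have dev j : {ae P, forall w, \forall m \near \oo,
    ~ count_deviation A p j.+1%:R^-1 (m.+1 ^ 2) w}.
  apply: borel_cantelli_ae => [m|]; first exact: measurable_count_deviation.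
  have j0 : 0 < j.+1%:R^-1 :> R by rewrite invr_gt0.
  apply: (@le_lt_trans _ _ (\sum_(0 <= m <oo)
      ((j.+1%:R ^+ 2)%:E * ((m.+1 ^ 2)%:R^-1 : R)%:E))%E).
    apply: lee_nneseries => // m _; rewrite -EFinM.
    have := count_deviation_le mA PA PAI j0 (isT : (0 < m.+1 ^ 2)%N).
    by rewrite exprVn invrK.
  rewrite nneseriesZl//.
  by apply: lte_mul_pinfty; [rewrite lee_fin sqr_ge0| |exact: nneseries_inv_sq_lt].
have /ae_foralln := dev; apply: filterS => w devw.
pose D n := event_count A n w - n%:R * p.
(* As [0 <= p <= 1], these increments lie in [[-1, 1]], which is the Lipschitz condition. *)
have DS n : D n.+1 - D n = \1_(A n) w - p.
  by rewrite /D /event_count big_ord_recr/= -natr1; ring.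
have D0 : D n / n%:R @[n --> \oo] --> (0 : R).
  apply: lipschitz_cvg_squares => [n|e e0].
    rewrite DS indicE ler_norml; case: (w \in A n) => /=; lra.
  have [j _ /(_ j (leqnn j)) je] := near_infty_natSinv_lt (PosNum e0).
  apply: filterS (devw j) => m /negP; rewrite -ltNge => /lt_le_trans; apply.
  by rewrite ler_pM2r ?ltr0n// ltW.
have Dp : D n / n%:R + p @[n --> \oo] --> p.
  by rewrite -[X in _ --> X]add0r; apply: cvgD D0 _; exact: cvg_cst.
apply: (cvg_trans _ Dp); apply: near_eq_cvg; near=> n.
have n0 : n%:R != 0 :> R by rewrite pnatr_eq0 -lt0n; near: n; exact: nbhs_infty_gt.
by rewrite /= /D /event_count; field.
Unshelve. all: by end_near. Qed.

(** * Empirical distribution functions and order statistics on one sample path *)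

Section empirical_counts.
Context {R : realType}.
Implicit Types (x : nat -> R) (n j : nat) (t l : R).

(** This is [n] times the empirical distribution function at [t]. *)
Definition count_le x n t : nat := #|[pred i : 'I_n | x i <= t]|.

(** In the sorted sample the values at most [t] form an initial segment. This trades order
    statistics for counts. *)
Lemma order_stat_le x n j t : (0 < j <= n)%N ->
  (order_stat x n j <= t) = (j <= count_le x n t)%N.
Proof.
move=> /andP[j0 jn]; rewrite /order_stat.
set s := sort _ _.
have ss : sorted <=%R s by apply: sort_sorted; exact: le_total.
have sz : size s = n by rewrite size_sort size_map size_iota.
have -> : count_le x n t = count (<= t) s.
  rewrite /s (permP (permEl (perm_sort _ _))) count_map -sum1_count.
  rewrite /count_le -sum1_card (eq_bigl (fun i : 'I_n => x i <= t))//.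
  by rewrite -(big_mkord (fun i => x i <= t) (fun=> 1%N)) /index_iota subn0.
have jE : (j.-1 < count (<= t) s)%N = (j <= count (<= t) s)%N by rewrite prednK.
rewrite -jE; case: ltnP => h; first exact: nth_count_le.
by apply/negbTE; rewrite -ltNge nth_count_gt// h sz prednK.
Qed.

Lemma count_le_card_lt x n t l : t < l ->
  (count_le x n t <= #|[pred i : 'I_n | (x i < l)%R]|)%N.
Proof.
move=> tl; apply: subset_leq_card; apply/fintype.subsetP => i.
by rewrite !inE => /le_lt_trans; apply.
Qed.

Lemma card_lt_count_le x n t l : l <= t ->
  (#|[pred i : 'I_n | (x i < l)%R]| <= count_le x n t)%N.
Proof.
move=> lt; apply: subset_leq_card; apply/fintype.subsetP => i.
by rewrite !inE => /ltW /le_trans; apply.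
Qed.

Lemma count_le_mono x n t l : t <= l -> (count_le x n t <= count_le x n l)%N.
Proof.
move=> tl; apply: subset_leq_card; apply/fintype.subsetP => i.
by rewrite !inE => /le_trans; apply.
Qed.

Lemma card_gt_count_le x n l :
  (#|[pred i : 'I_n | (l < x i)%R]| = n - count_le x n l)%N.
Proof.
rewrite -[X in (X - _)%N](card_ord n) /count_le -(cardC [pred i : 'I_n | x i <= l]).
by rewrite addKn; apply: eq_card => i; rewrite !inE ltNge.
Qed.

(** At a rational [r < a] the limit frequency [F r] is below [q], so eventually fewer than [j k]
    observations are at most [r] and the order statistic exceeds [r]. A rational above [a] gives the
    other bound. *)
Lemma order_stat_cvg x (n j : nat -> nat) (F : R -> R) (a q : R) :
  (forall r : rat, (count_le x (n k) (ratr r))%:R / (n k)%:R @[k --> \oo]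
    --> F (ratr r)) ->
  (\forall k \near \oo, (0 < j k <= n k)%N) ->
  (j k)%:R / (n k)%:R @[k --> \oo] --> q ->
  (forall t, t < a -> F t < q) -> (forall t, a < t -> q < F t) ->
  order_stat x (n k) (j k) @[k --> \oo] --> a.
Proof.
move=> cF jn jq Fl Fr; apply/cvgrPdist_le => e e0.
have [r] : exists r : rat, ratr r \in `]a - e, a[.
  by apply: rat_in_itvoo; rewrite ltrBlDr ltrDl.
have [s] : exists s : rat, ratr s \in `]a, a + e[.
  by apply: rat_in_itvoo; rewrite ltrDl.
rewrite !in_itv/= => /andP[as_ se] /andP[er ra].
have Hr : \forall k \near \oo,
    (count_le x (n k) (ratr r))%:R / (n k)%:R - (j k)%:R / (n k)%:R < 0 :> R.
  by apply: cvgr_lt (cvgB (cF r) jq) _ _; rewrite subr_lt0 Fl.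
have Hs : \forall k \near \oo,
    0 < (count_le x (n k) (ratr s))%:R / (n k)%:R - (j k)%:R / (n k)%:R :> R.
  by apply: cvgr_gt (cvgB (cF s) jq) _ _; rewrite subr_gt0 Fr.
near=> k.
have jk : (0 < j k <= n k)%N by near: k.
have n0 : 0 < (n k)%:R^-1 :> R.
  by rewrite invr_gt0 ltr0n; case/andP: jk => /leq_trans; apply.
have : ratr r < order_stat x (n k) (j k).
  rewrite ltNge order_stat_le// -ltnNge -(ltr_nat R) -(ltr_pM2r n0) -subr_lt0.
  by near: k.
have : order_stat x (n k) (j k) <= ratr s.
  rewrite order_stat_le// -(ler_nat R) -(ler_pM2r n0) -subr_ge0 ltW//.
  by near: k.
rewrite ler_norml; lra.
Unshelve. all: by end_near. Qed.

(** Convergence of [G k] is given at fixed rationals, whereas [L k] moves. Rationals [r < l < s]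
    eventually enclose [L k], which puts [N k] between [G k r] and [G k s]. *)
Lemma sandwich_cvg (F : R -> R) (G : nat -> R -> R) (N L : nat -> R) (l p : R) :
  (forall r : rat, G k (ratr r) @[k --> \oo] --> F (ratr r)) ->
  L k @[k --> \oo] --> l -> F t @[t --> l] --> F l ->
  (forall k t, t < L k -> G k t <= N k) ->
  (forall k t, L k <= t -> N k <= G k t) ->
  (forall t, t < l -> F t <= p) -> (forall t, l < t -> p <= F t) ->
  N k @[k --> \oo] --> p.
Proof.
move=> cG cL cF GN NG Fp pF; apply/cvgrPdist_le => e e0.
(* Here [F r <= p <= F s], both ends being within [e / 4] of [F l]; one more [e / 4] pays for the
   convergence of [G k]. *)
have e4 : 0 < e / 4 by rewrite divr_gt0.
have [dl /= dl0 Fdl] := cvgr_dist_lt _ _ cF _ e4.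
have [r] : exists r : rat, ratr r \in `]l - dl, l[.
  by apply: rat_in_itvoo; rewrite ltrBlDr ltrDl.
have [s] : exists s : rat, ratr s \in `]l, l + dl[.
  by apply: rat_in_itvoo; rewrite ltrDl.
rewrite !in_itv/= => /andP[ls sl] /andP[lr rl].
have := Fp _ rl; have := pF _ ls.
have := Fdl (ratr r); have := Fdl (ratr s).
rewrite /= !ltr_norml => /(_ _)/andP[|? ?]; first by apply/andP; split; lra.
move=> /(_ _)/andP[|? ? ? ?]; first by apply/andP; split; lra.
near=> k.
have : `|F (ratr r) - G k (ratr r)| < e / 4 by near: k; exact: (cvgr_dist_lt _ _ (cG _)).
have : `|F (ratr s) - G k (ratr s)| < e / 4 by near: k; exact: (cvgr_dist_lt _ _ (cG _)).
have rL : ratr r < L k by near: k; exact: (cvgr_gt _ cL).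
have Ls : L k < ratr s by near: k; exact: (cvgr_lt _ cL).
have := GN _ _ rL; have := NG _ _ (ltW Ls).
rewrite ler_norml !ltr_norml => ? ? /andP[? ?] /andP[? ?]; apply/andP; split; lra.
Unshelve. all: by end_near. Qed.

End empirical_counts.

(** * The cumulative distribution function and its quantiles *)

Lemma abs_continuous_continuous {R : realType} (F : R -> R) :
  abs_continuous F -> continuous F.
Proof.
move=> acF x; apply/cvgrPdist_lt => e e0.
have [dl dl0 Fdl] := acF _ e0.
have Fab a b : a <= b -> b - a < dl -> `|F b - F a| < e.
  (* A family consisting of one interval is trivially disjoint. *)
  move=> ab bad; have := Fdl 1%N (fun=> a) (fun=> b) (fun=> ab).
  rewrite !big_ord_recl !big_ord0 !addr0; apply => //.
  by move=> i j _ _ _; rewrite !ord1.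
exists dl => //= y /= xy.
have [h|/ltW h] := leP x y; [rewrite distrC|]; apply: Fab => //;
  by move: xy; rewrite ltr_norml => /andP[]; lra.
Qed.

Section cdf_facts.
Context {d : measure_display} {T : measurableType d} {R : realType}.
Variables (P : probability T R) (X : {RV P >-> R}).

Lemma measurable_le_RV (Y : {RV P >-> R}) (t : R) :
  measurable (Y @^-1` [set y | y <= t]).
Proof.
rewrite -[X in measurable X]setTI; apply: measurable_funP => //.
by rewrite -set_itvNyc.
Qed.

Lemma rcdfE (t : R) : (rcdf X t)%:E = P (X @^-1` [set y | y <= t]).
Proof.
by rewrite /rcdf /cdf fineK ?fin_num_measure.
Qed.

Lemma le_rcdf (t u : R) : t <= u -> rcdf X t <= rcdf X u.
Proof. by move=> tu; rewrite fine_le ?fin_num_measure ?cdf_nondecreasing. Qed.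

Lemma rcdf_lt_exists (q : R) : 0 < q -> exists t, rcdf X t < q.
Proof.
move=> q0; have := cvg_cdfNy0 X; move/fine_cvgP => [_].
move=> /cvgr_lt /(_ _ q0) [M [_ HM]].
by exists (M - 1); apply: HM; rewrite ltrBlDr ltrDl.
Qed.

Lemma rcdf_gt_exists (q : R) : q < 1 -> exists t, q < rcdf X t.
Proof.
move=> q1; have := cvg_cdfy1 X; move/fine_cvgP => [_].
move=> /cvgr_gt /(_ _ q1) [M [_ HM]].
by exists (M + 1); apply: HM; rewrite ltrDl.
Qed.

(** A [t] with [q <= F t] belongs to the set whose infimum is the quantile; this set is bounded
    below because [F] tends to 0 at minus infinity. *)
Lemma lt_quantile (q t : R) : 0 < q -> t < quantile X q -> rcdf X t < q.
Proof.
move=> q0; rewrite !ltNge; apply: contra => qt; apply: ge_inf => //.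
have [u uq] := rcdf_lt_exists q0; exists u => v /= qv.
by rewrite leNgt; apply/negP => /ltW/le_rcdf; lra.
Qed.

(** Read as a supremum through the convention, the quantile bounds every [t] with [F t <= q], so no
    flat piece of [F] at height [q] extends to its right. *)
Lemma gt_quantile (q t : R) : q < 1 -> quantile_convention X q ->
  quantile X q < t -> q < rcdf X t.
Proof.
move=> q1 ->; rewrite !ltNge; apply: contra => qt; apply: ub_le_sup => //.
have [u uq] := rcdf_gt_exists q1; exists u => v /= qv.
by rewrite leNgt; apply/negP => /ltW/le_rcdf; lra.
Qed.

(** Inclusions of events give the bracketing conditions that [sandwich_cvg] asks of the limit
    [P (X < l)]. *)
Lemma prob_lt_between (l t : R) :
  (t < l -> rcdf X t <= fine (P [set w | X w < l])) /\
  (l < t -> fine (P [set w | X w < l]) <= rcdf X t).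
Proof.
have ml : measurable [set w | X w < l].
  rewrite -[X in measurable X]setTI.
  rewrite [X in _ `&` X](_ : _ = X @^-1` [set y | y < l])//.
  by apply: measurable_funP => //; rewrite -set_itvNyo.
split=> tl; rewrite -lee_fin rcdfE fineK ?fin_num_measure//;
  apply: le_measure; rewrite ?inE//; try exact: measurable_le_RV.
- by move=> w /= /le_lt_trans; apply.
- by move=> w /= /ltW /le_trans; apply; exact: ltW.
Qed.

Lemma prob_gt (r : R) : fine (P [set w | r < X w]) = 1 - rcdf X r.
Proof.
rewrite [X in P X](_ : _ = ~` (X @^-1` [set y | y <= r])); last first.
  by apply/seteqP; split => w /=; rewrite ltNge => /negP.
rewrite probability_setC; last exact: measurable_le_RV.
by rewrite -rcdfE.
Qed.

Lemma ae_cvg_count_le (X_ : nat -> {RV P >-> R}) (t : R) :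
  independent_observations X X_ ->
  {ae P, forall w,
    (count_le (X_ ^~ w) n t)%:R / n%:R @[n --> \oo] --> rcdf X t}.
Proof.
move=> [ind idd]; pose A i := X_ i @^-1` [set y | y <= t].
have mt : measurable [set y : R | y <= t] by rewrite -set_itvNyc.
have PA i : P (A i) = (rcdf X t)%:E by rewrite rcdfE; exact: idd.
have PAI i j : i != j -> P (A i `&` A j) = (rcdf X t * rcdf X t)%:E.
  (* Mutual independence on the index set [{i, j}] yields the pairwise product rule. *)
  move=> ij; have := ind [fset i; j]%fset (fun=> [set y | y <= t]) (fun=> mt).
  rewrite bigcap_fsetU1 set_fset1 bigcap_set1.
  rewrite big_fsetU1 ?inE//= big_seq_fset1 EFinM.
  by rewrite -/(A i) -/(A j) !PA.
have := strong_law_events (fun i => measurable_le_RV (X_ i) t) PA PAI.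
apply: filterS => w; apply: cvg_trans; apply: near_eq_cvg; apply: nearW => n /=.
congr (_ / _); rewrite /count_le -sum1_card natr_sum [RHS]big_mkcond/=.
apply: eq_bigr => i _; rewrite indicE unfold_in/=.
case: ifPn => [h|/negP h]; first by rewrite mem_set.
by rewrite memNset.
Qed.

Lemma ae_count_le_rat (X_ : nat -> {RV P >-> R}) :
  independent_observations X X_ ->
  {ae P, forall w, forall r : rat,
    (count_le (X_ ^~ w) n (ratr r))%:R / n%:R @[n --> \oo] --> rcdf X (ratr r)}.
Proof.
move=> indX.
(* The rationals are enumerated by [unpickle], so that the exceptional sets form a sequence; a code
   of no rational imposes nothing. *)
have /ae_foralln : forall m : nat, {ae P, forall w, forall r : rat,
    @choice.unpickle rat m = Some r ->
    (count_le (X_ ^~ w) n (ratr r))%:R / n%:R @[n --> \oo] --> rcdf X (ratr r)}.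
  move=> m; case: (choice.unpickle m) => [r|]; last exact: aeW.
  by apply: filterS (ae_cvg_count_le (ratr r) indX) => w ? _ [<-].
by apply: filterS => w H r; apply: (H (choice.pickle r)); rewrite choice.pickleK.
Qed.

End cdf_facts.

(** * Empirical quantiles and fences along the sample sizes [(s + 1) k - 1] *)

Lemma cvg_subsequence_infty (s : nat) : (0 < s)%N ->
  (s.+1 * k - 1)%N @[k --> \oo] --> \oo.
Proof.
move=> s0; apply/cvgnyPge => A; exists A.+1 => // k /= Ak; nia.
Qed.

Lemma cvg_scaled_index_ratio {R : realType} (s c : nat) : (0 < s)%N ->
  (c * k)%:R / (s.+1 * k - 1)%:R @[k --> \oo] --> (c%:R / s.+1%:R : R).
Proof.
move=> s0; set q : R := c%:R / s.+1%:R.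
have inv0 : (n%:R^-1 : R) @[n --> \oo] --> (0 : R).
  by rewrite -cvg_shiftS; exact: cvg_harmonic.
have inv0s := cvg_comp _ _ (cvg_subsequence_infty s0) inv0.
(* With [n = (s + 1) k - 1] one has [k = (n + 1) / (s + 1)], so the ratio is
   [q (n + 1) / n = q + q / n]. *)
have qq : q + q * (s.+1 * k - 1)%:R^-1 @[k --> \oo] --> q.
  rewrite -[X in _ --> X]addr0 -[X in _ --> q + X](mulr0 q).
  by apply: cvgD; [exact: cvg_cst|apply: cvgM; [exact: cvg_cst|]].
apply: (cvg_trans _ qq); apply: near_eq_cvg; near=> k.
have k0 : (0 < k)%N by near: k; exact: nbhs_infty_gt.
have n0 : (0 < s.+1 * k - 1)%N by nia.
have nE : (s.+1 * k - 1)%:R + 1 = s.+1%:R * k%:R :> R.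
  by rewrite natr1 -natrM; congr (_%:R); nia.
have n0R : (s.+1 * k - 1)%:R != 0 :> R by rewrite pnatr_eq0 -lt0n.
have kE : k%:R = ((s.+1 * k - 1)%:R + 1) / s.+1%:R :> R.
  by rewrite nE mulrAC mulfV ?mul1r.
by rewrite /q natrM kE; field; rewrite n0R nat1r pnatr_eq0.
Unshelve. all: by end_near. Qed.

Section fences.
Context {d : measure_display} {T : measurableType d} {R : realType}.
Variables (P : probability T R) (X : {RV P >-> R}) (s : nat) (x : nat -> R).
Hypothesis s0 : (0 < s)%N.
Hypothesis cvx : forall r : rat,
  (count_le x n (ratr r))%:R / n%:R @[n --> \oo] --> rcdf X (ratr r).

Lemma emp_quantile_cvg (c : nat) : (0 < c <= s)%N ->
  quantile_convention X (c%:R / s.+1%:R) ->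
  emp_quantile x (s.+1 * k - 1) (c%:R / s.+1%:R) @[k --> \oo]
    --> quantile X (c%:R / s.+1%:R).
Proof.
move=> /andP[c0 cs]; set q : R := c%:R / s.+1%:R => conv.
have q0 : 0 < q by rewrite divr_gt0 ?ltr0n.
have q1 : q < 1 by rewrite ltr_pdivrMr ?ltr0n// mul1r ltr_nat.
have H : order_stat x (s.+1 * k - 1) (c * k) @[k --> \oo] --> quantile X q.
  apply: (@order_stat_cvg R x (fun k => s.+1 * k - 1)%N (fun k => c * k)%N
    (rcdf X) (quantile X q) q).
  - by move=> r; exact: (cvg_comp _ _ (cvg_subsequence_infty s0) (@cvx r)).
  - by exists 1%N => // k /= k1; nia.
  - exact: cvg_scaled_index_ratio.
  - by move=> t; exact: lt_quantile.
  - by move=> t; exact: gt_quantile.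
apply: (cvg_trans _ H); apply: near_eq_cvg; near=> k.
(* For [0 < k] the natural subtraction is exact and [n + 1 = (s + 1) k], so the rank [(n + 1) q] is
   the integer [c k] and truncation loses nothing. *)
have k0 : (0 < k)%N by near: k; exact: nbhs_infty_gt.
rewrite /emp_quantile; congr order_stat.
have -> : (s.+1 * k - 1).+1%:R * q = (c * k)%:R.
  rewrite (_ : (s.+1 * k - 1).+1 = s.+1 * k)%N; last by nia.
  by rewrite /q !natrM; field; rewrite nat1r pnatr_eq0.
by apply/esym/truncn_def; rewrite lexx ltr_nat ltnS leqnn.
Unshelve. all: by end_near. Qed.

Hypothesis acF : abs_continuous (rcdf X).
Hypothesis conv_l : quantile_convention X (1 / s.+1%:R).
Hypothesis conv_r : quantile_convention X (s%:R / s.+1%:R).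

Let p : R := 1 / s.+1%:R.

Let onem_p : 1 - p = s%:R / s.+1%:R.
Proof. by rewrite /p -natr1; field; rewrite natr1 pnatr_eq0. Qed.

Let cvg_l : emp_quantile x (s.+1 * k - 1) p @[k --> \oo] --> quantile X p.
Proof. exact: (@emp_quantile_cvg 1 s0 conv_l). Qed.

Let cvg_r : emp_quantile x (s.+1 * k - 1) (1 - p) @[k --> \oo]
  --> quantile X (1 - p).
Proof. by rewrite onem_p; apply: emp_quantile_cvg => //; rewrite s0 leqnn. Qed.

Lemma left_fence_cvg :
  left_fence (emp_quantile x (s.+1 * k - 1)) p @[k --> \oo]
    --> left_fence (quantile X) p.
Proof. by apply: cvgB; apply: cvgM => //; exact: cvg_cst. Qed.

Lemma right_fence_cvg :
  right_fence (emp_quantile x (s.+1 * k - 1)) p @[k --> \oo]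
    --> right_fence (quantile X) p.
Proof. by apply: cvgB; apply: cvgM => //; exact: cvg_cst. Qed.

Let freq (k : nat) (t : R) : R :=
  (count_le x (s.+1 * k - 1) t)%:R / (s.+1 * k - 1)%:R.

Let cvx_sub (r : rat) : freq k (ratr r) @[k --> \oo] --> rcdf X (ratr r).
Proof. exact: (cvg_comp _ _ (cvg_subsequence_infty s0) (@cvx r)). Qed.

(** The number of values strictly below the fence lies between [count_le] at points left of it and
    [count_le] from it on, as [sandwich_cvg] requires. *)
Lemma n_left_ratio_cvg :
  (n_left x (s.+1 * k - 1) p)%:R / (s.+1 * k - 1)%:R @[k --> \oo]
    --> p_left X p.
Proof.
have cF := @abs_continuous_continuous _ _ acF (left_fence (quantile X) p).
apply: (sandwich_cvg (G := freq) cvx_sub left_fence_cvg cF).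
- by move=> k t tL; rewrite /freq ler_wpM2r ?invr_ge0// ler_nat count_le_card_lt.
- by move=> k t Lt; rewrite /freq ler_wpM2r ?invr_ge0// ler_nat card_lt_count_le.
- by move=> t; case: (prob_lt_between X (left_fence (quantile X) p) t).
- by move=> t; case: (prob_lt_between X (left_fence (quantile X) p) t).
Qed.

Lemma n_right_ratio_cvg :
  (n_right x (s.+1 * k - 1) p)%:R / (s.+1 * k - 1)%:R @[k --> \oo]
    --> p_right X p.
Proof.
set r := right_fence (quantile X) p.
have cF := @abs_continuous_continuous _ _ acF r.
pose rk k := right_fence (emp_quantile x (s.+1 * k - 1)) p.
(* Right outside values are the complement of the values at most the fence, so the sandwich is
   applied to the frequency of the latter. *)
have cle : freq k (rk k) @[k --> \oo] --> rcdf X r.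
  apply: (sandwich_cvg (G := freq) cvx_sub right_fence_cvg cF).
  - by move=> k t /ltW tr; rewrite /freq ler_wpM2r ?invr_ge0// ler_nat count_le_mono.
  - by move=> k t rt; rewrite /freq ler_wpM2r ?invr_ge0// ler_nat count_le_mono.
  - by move=> t /ltW; exact: le_rcdf.
  - by move=> t /ltW; exact: le_rcdf.
rewrite /p_right prob_gt -/r.
have H : 1 - freq k (rk k) @[k --> \oo] --> 1 - rcdf X r.
  by apply: cvgB; first exact: cvg_cst.
apply: (cvg_trans _ H); apply: near_eq_cvg; near=> k.
have k0 : (0 < k)%N by near: k; exact: nbhs_infty_gt.
rewrite /n_right card_gt_count_le natrB; last first.
  by rewrite -[leqRHS]card_ord max_card.
rewrite mulrBl mulfV// pnatr_eq0 -lt0n; nia.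
Unshelve. all: by end_near. Qed.

End fences.

Theorem theorem6 (d : measure_display) (T : measurableType d) (R : realType)
    (P : probability T R) (X : {RV P >-> R}) (X_ : nat -> {RV P >-> R})
    (s : nat)
    (s_ge2 : (2 <= s)%N)
    (indX : independent_observations X X_)
    (acF : abs_continuous (rcdf X))
    (conv_l : quantile_convention X (1 / s.+1%:R))
    (conv_r : quantile_convention X (s%:R / s.+1%:R))
    (f_l : pdf_quantile_pos_finite X (1 / s.+1%:R))
    (f_r : pdf_quantile_pos_finite X (s%:R / s.+1%:R)) :
  {ae P, forall w,
     (n_left (X_ ^~ w) (s.+1 * k - 1) (1 / s.+1%:R))%:R / (s.+1 * k - 1)%:R
       @[k --> \oo] --> p_left X (1 / s.+1%:R)} /\
  {ae P, forall w,
     (n_right (X_ ^~ w) (s.+1 * k - 1) (1 / s.+1%:R))%:R / (s.+1 * k - 1)%:R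
       @[k --> \oo] --> p_right X (1 / s.+1%:R)}.
Proof.
have s0 : (0 < s)%N by exact: ltnW.
(* The same almost sure event, convergence at all rationals, serves both fences. *)
by split; apply: filterS (ae_count_le_rat indX) => w cvx;
  [exact: n_left_ratio_cvg|exact: n_right_ratio_cvg].
Qed.
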